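(* Let $G_1=(V,E_1)$ be a distance-regular graph with diameter $d\ge2$ and let $G_2=(V,E_2)$ be its distance-$2$ graph, with respective adjacency matrices $A_1$ and $A_2$ and respective degrees $k_1$ and $k_2$. Let $P$ be the first eigenmatrix of the association scheme generated by $A_1$, with rows ordered so that $P_{d1}<\dots<P_{11}<P_{01}$. Then $$\gamma^\circ(G_1,G_2)=\begin{cases}\dfrac{k_1}{k_1-P_{d1}},&\text{if }k_2P_{d1}+k_1P_{d2}>0,\\[2ex]\dfrac{k_1}{k_1-P_{d1}}-\dfrac{k_2P_{d1}+k_1P_{d2}}{2k_2(k_1-P_{d1})},&\text{otherwise.}\end{cases}$$
   Context: Graphs are finite, simple, undirected and loopless. For graphs $G_1=(V,E_1)$, $G_2=(V,E_2)$ and a real symmetric matrix $N$ indexed by $V$, let $\mathcal{L}^*(N)\in\mathbb{R}^{E_1}$ and $\mathcal{K}^*(N)\in\mathbb{R}^{E_2}$ be given by $\mathcal{L}^*(N)_{ij}=N_{ii}+N_{jj}-2N_{ij}$ for $ij\in E_1$ and $\mathcal{K}^*(N)_{ij}=N_{ii}+N_{jj}+2N_{ij}$ for $ij\in E_2$. With $\succcurlyeq0$ meaning positive semidefinite, $\mathrm{diag}(N)$ the vector of diagonal entries and $\mathbb{1}$ the all-ones vector, define $$\gamma^\circ(G_1,G_2)=\min\{\mu : \mu\ge0,\ N\succcurlyeq0,\ \mathrm{diag}(N)=\mu\cdot\mathbb{1},\ \tfrac12\mathcal{L}^*(N)\ge\mathbb{1},\ \tfrac12\mathcal{K}^*(N)\ge\mathbb{1}\}.$$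 The distance-$i$ graph of $G_1$ has vertex set $V$, two vertices being adjacent when they are at distance $i$ in $G_1$; let $A_i$ be its adjacency matrix and $A_0=I$. For $G_1$ distance-regular (in the standard sense, in particular connected) with diameter $d$, $\{A_0,A_1,\dots,A_d\}$ is the association scheme generated by $A_1$: the $A_i$ are commuting symmetric $01$-matrices summing to the all-ones matrix $J$, whose span is an algebra. This span has a basis of primitive idempotents $E_0=\frac1{|V|}J,E_1,\dots,E_d$ (the orthogonal projectors onto the common eigenspaces). The first eigenmatrix $P$, with rows and columns indexed by $0,\dots,d$, is defined by $A_i=\sum_{l=0}^dP_{li}E_l$; thus $P_{01}=k_1,P_{11},\dots,P_{d1}$ are the $d+1$ distinct eigenvalues of $A_1$, and $k_i=P_{0i}$ is the degree of the distance-$i$ graph. *)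

(* Defs.v *)
From HB Require Import structures.
From mathcomp Require Import all_boot all_order all_algebra.
From mathcomp Require Import reals.

Set Implicit Arguments.
Unset Strict Implicit.
Unset Printing Implicit Defensive.

Import Order.TTheory GRing.Theory Num.Theory.
Local Open Scope ring_scope.

(* A graph on V is given by its adjacency relation. *)
Definition simple_graph (V : finType) (e : rel V) : Prop :=
  symmetric e /\ irreflexive e.

Definition regular (V : finType) (e : rel V) (k : nat) : Prop :=
  forall x : V, #|[set y | e x y]| = k.

Definition walk (V : finType) (e : rel V) (i : nat) : rel V :=
  fun x y => [exists p : i.-tuple V, path e x p && (last x p == y)].

(* For 0 < i this is the adjacency relation of the distance-i graph; for i = 0
   it is equality. *)
Definition at_distance (V : finType) (e : rel V) (i : nat) : rel V :=
  fun x y => walk e i x y && [forall j : 'I_i, ~~ walk e j x y].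

Definition has_diameter (V : finType) (e : rel V) (d : nat) : Prop :=
  (exists x y : V, at_distance e d x y) /\
  (forall x y : V, exists2 i : nat, (i <= d)%N & at_distance e i x y).

(* b and c form the intersection array; c_0 = 0 carries no information. *)
Definition distance_regular (V : finType) (e : rel V) : Prop :=
  (forall x y : V, connect e x y) /\
  exists b c : nat -> nat, forall (i : nat) (x y : V),
    (at_distance e i x y ->
       #|[set z | e y z & at_distance e i.+1 x z]| = b i) /\
    (at_distance e i.+1 x y ->
       #|[set z | e y z & at_distance e i x z]| = c i.+1).

(* Matrices indexed by V are indexed by 'I_#|V| through the enumeration of V. *)
Definition adjmx (R : realType) (V : finType) (e : rel V) : 'M[R]_#|V| :=
  \matrix_(i, j) (e (enum_val i) (enum_val j))%:R.

Definition scheme_span (R : realType) (V : finType) (e : rel V) (d : nat) :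
    {vspace 'M[R]_#|V|} :=
  <<[tuple adjmx R (at_distance e i) | i < d.+1]>>%VS.

Definition primitive_idempotent (R : realType) (n : nat)
    (B : {vspace 'M[R]_n}) (E : 'M[R]_n) : Prop :=
  [/\ E \in B, E != 0, E *m E = E &
      forall F F' : 'M[R]_n, F \in B -> F' \in B ->
        F *m F = F -> F' *m F' = F' -> F *m F' = 0 -> F' *m F = 0 ->
        E = F + F' -> F = 0 \/ F' = 0].

Definition idempotent_basis (R : realType) (V : finType) (e : rel V) (d : nat)
    (E : 'I_d.+1 -> 'M[R]_#|V|) : Prop :=
  [/\ basis_of (scheme_span R e d) [tuple E l | l < d.+1],
      forall l, primitive_idempotent (scheme_span R e d) (E l),
      forall l m, l != m -> E l *m E m = 0 &
      E ord0 = #|V|%:R^-1 *: const_mx 1].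

Definition first_eigenmatrix (R : realType) (V : finType) (e : rel V) (d : nat)
    (P : 'M[R]_d.+1) : Prop :=
  exists2 E : 'I_d.+1 -> 'M[R]_#|V|, idempotent_basis e E &
    forall i : 'I_d.+1,
      adjmx R (at_distance e i) = \sum_(l < d.+1) P l i *: E l.

Definition psd (R : realType) (n : nat) (N : 'M[R]_n) : Prop :=
  N^T = N /\ forall x : 'cV[R]_n, 0 <= (x^T *m N *m x) 0 0.

Definition Lstar (R : realType) (n : nat) (N : 'M[R]_n) (i j : 'I_n) : R :=
  N i i + N j j - 2 * N i j.

Definition Kstar (R : realType) (n : nat) (N : 'M[R]_n) (i j : 'I_n) : R :=
  N i i + N j j + 2 * N i j.

Definition gamma_feasible (R : realType) (V : finType) (e1 e2 : rel V)
    (mu : R) (N : 'M[R]_#|V|) : Prop :=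
  [/\ 0 <= mu, psd N, forall i, N i i = mu,
      forall i j, e1 (enum_val i) (enum_val j) -> 1 <= 2^-1 * Lstar N i j &
      forall i j, e2 (enum_val i) (enum_val j) -> 1 <= 2^-1 * Kstar N i j].

(* The minimum is stated relationally, so that its attainment is part of the
   assertion. *)
Definition is_gamma_circ (R : realType) (V : finType) (e1 e2 : rel V)
    (g : R) : Prop :=
  (exists N, gamma_feasible e1 e2 g N) /\
  (forall mu N, gamma_feasible e1 e2 mu N -> g <= mu).

(* Main.v *)
Require Import Defs.
From HB Require Import structures.
From mathcomp Require Import all_boot all_order all_algebra.
From mathcomp Require Import reals.
From mathcomp Require Import ring lra.

Set Implicit Arguments.
Unset Strict Implicit.
Unset Printing Implicit Defensive.

Import Order.TTheory GRing.Theory Num.Theory.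
Local Open Scope ring_scope.

(** If [Z = z I + x A_1 - y A_2] is positive semidefinite with [x, y >= 0], then
    [0 <= tr (N Z)] for every feasible [N], which bounds [mu] from below by
    [(x k_1 + y k_2) / (z + x k_1 + y k_2)].  As [P_l2] is a convex quadratic
    function of [P_l1], the eigenvalues [z + x P_l1 - y P_l2] of [Z] are
    nonnegative once they are so for [l = 0] and [l = d].  The choice
    [(z, x, y) = (- P_d1, 1, 0)] gives the first value of the theorem, and
    making both extreme eigenvalues vanish gives the second.  They are attained
    by combinations of [J] and [E_d] with nonnegative coefficients. *)

(** * Walks and distances in a graph *)

Section Distance.
Variables (V : finType) (e : rel V).
Implicit Types (x y z : V) (p : seq V) (i j d : nat).

Lemma walkP i x y :
  reflect (exists p, [/\ size p = i, path e x p & last x p = y]) (walk e i x y).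
Proof.
apply: (iffP existsP) => [[p /andP[ep /eqP lp]]|[p [sp ep lp]]].
  by exists p; rewrite size_tuple.
have sp' : size p == i by rewrite sp.
by exists (Tuple sp'); rewrite /= ep lp eqxx.
Qed.

Lemma walk0 x y : walk e 0 x y = (x == y).
Proof.
apply/walkP/eqP => [[p [/size0nil -> _ //]]|->]; by exists [::].
Qed.

Lemma walkS i x y : walk e i.+1 x y = [exists z, e x z && walk e i z y].
Proof.
apply/walkP/existsP => [[[|z p] []] //= [sp] /andP[exz ep] lp|[z /andP[exz]]].
  by exists z; rewrite exz; apply/walkP; exists p.
by case/walkP=> p [<- ep lp]; exists (z :: p); rewrite /= exz.
Qed.

Lemma walk1 x y : walk e 1 x y = e x y.
Proof.
rewrite walkS; apply/existsP/idP => [[z]|exy].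
  by rewrite walk0 => /andP[exz /eqP <-].
by exists y; rewrite exy walk0 eqxx.
Qed.

Lemma walk_cat i j x y z : walk e i x y -> walk e j y z -> walk e (i + j) x z.
Proof.
move=> /walkP[p [<- ep lp]] /walkP[q [<- eq lq]]; apply/walkP; exists (p ++ q).
by rewrite size_cat cat_path last_cat lp ep.
Qed.

Lemma at_distance0 x y : at_distance e 0 x y = (x == y).
Proof.
by rewrite /at_distance walk0; case: eqP => //= _; apply/forallP => -[].
Qed.

Lemma at_distance_inj i j x y :
  at_distance e i x y -> at_distance e j x y -> i = j.
Proof.
move=> /andP[wi /forallP ni] /andP[wj /forallP nj].
case: (ltngtP i j) => // lt_ij.
  by have := nj (Ordinal lt_ij); rewrite wi.
by have := ni (Ordinal lt_ij); rewrite wj.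
Qed.

Lemma at_distance_sym i : symmetric e -> symmetric (at_distance e i).
Proof.
move=> e_sym.
have w_sym j x y : walk e j x y -> walk e j y x.
  case/walkP=> p [<- ep <-]; apply/walkP; exists (rev (belast x p)).
  rewrite size_rev size_belast rev_path.
  rewrite (eq_path (e' := e)); last by move=> u v; rewrite e_sym.
  split=> //; case: p {ep} => [|z p] //=.
  by rewrite rev_cons last_rcons.
have w_symE j x y : walk e j x y = walk e j y x.
  by apply/idP/idP; apply: w_sym.
move=> x y; rewrite /at_distance w_symE; congr (_ && _).
by apply: eq_forallb => j; rewrite w_symE.
Qed.

Lemma at_distance1 x y : irreflexive e -> at_distance e 1 x y = e x y.
Proof.
move=> e_irr; rewrite /at_distance walk1; case exy: (e x y) => //=.
apply/forallP => -[[|//] ?] /=; rewrite walk0.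
by apply: contraTneq exy => <-; rewrite e_irr.
Qed.

Lemma at_distance2 x y :
  at_distance e 2 x y =
    [&& x != y, ~~ e x y & [exists z, e x z && e z y]].
Proof.
rewrite /at_distance walkS.
rewrite (_ : [exists z, _] = [exists z, e x z && e z y]); last first.
  by apply: eq_existsb => z; rewrite walk1.
rewrite andbC andbA; congr (_ && _).
apply/forallP/andP => [n|[n0 n1] [[|[|//]] ?]] /=.
- have n0 := n (Ordinal (isT : (0 < 2)%N)).
  have n1 := n (Ordinal (isT : (1 < 2)%N)).
  by rewrite -walk0 -walk1.
- by rewrite walk0.
- by rewrite walk1.
Qed.

(** An initial segment of a shortest walk is itself a shortest walk. A pair at distance [d] thus
    yields pairs at distances 1 and 2, so that [k1] and [k2] are positive. *)
Lemma at_distance_take i j x y :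
  (i <= j)%N -> at_distance e j x y -> exists z, at_distance e i x z.
Proof.
move=> le_ij /andP[/walkP[p [sp ep lp]] /forallP nw].
have /walkP w2 : exists q,
    [/\ size q = (j - i)%N, path e (last x (take i p)) q
      & last (last x (take i p)) q = y].
  exists (drop i p); rewrite size_drop sp -last_cat cat_take_drop.
  by move: ep; rewrite -{1}(cat_take_drop i p) cat_path => /andP[].
exists (last x (take i p)); apply/andP; split.
  apply/walkP; exists (take i p); rewrite size_take_min sp (minn_idPl le_ij).
  by move: ep; rewrite -{1}(cat_take_drop i p) cat_path => /andP[].
(* A walk of length [m < i] to the intermediate vertex, followed by the remaining [j - i] steps,
   would join [x] to [y] in fewer than [j] steps. *)
apply/forallP => m; apply/negP => wm.
have lt : (m + (j - i) < j)%N.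
  by rewrite -{2}(subnKC le_ij) ltn_add2r ltn_ord.
by have := nw (Ordinal lt); rewrite (walk_cat wm w2).
Qed.

End Distance.

(** * Adjacency matrices of the distance graphs and their span *)

Section AdjacencyMatrix.
Variables (R : realType) (V : finType).
Implicit Types (e : rel V) (k : nat).

Lemma sum_enum_val (F : V -> R) : \sum_(i < #|V|) F (enum_val i) = \sum_x F x.
Proof. by rewrite [RHS](reindex _ (onW_bij _ (@enum_val_bij V))). Qed.

Lemma sum_indicator (a : pred V) : \sum_x (a x)%:R = #|[set x | a x]|%:R :> R.
Proof.
rewrite -sum1dep_card natr_sum [RHS]big_mkcond /=.
by apply: eq_bigr => x _; case: (a x).
Qed.

Lemma eq_adjmx e e' : e =2 e' -> adjmx R e = adjmx R e'.
Proof. by move=> ee; apply/matrixP => i j; rewrite !mxE ee. Qed.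

Lemma tr_adjmx e : symmetric e -> (adjmx R e)^T = adjmx R e.
Proof. by move=> e_sym; apply/matrixP => i j; rewrite !mxE e_sym. Qed.

Lemma adjmx_at_distance0 e : adjmx R (at_distance e 0) = 1%:M.
Proof.
by apply/matrixP => i j; rewrite !mxE at_distance0 (inj_eq enum_val_inj).
Qed.

Lemma sum_adjmx_row e k i : regular e k -> \sum_j adjmx R e i j = k%:R.
Proof.
move=> reg; under eq_bigr do rewrite mxE.
by rewrite (sum_enum_val (fun y => (e (enum_val i) y)%:R)) sum_indicator reg.
Qed.

Lemma regular_gt0 e k x y : regular e k -> e x y -> (0 < k)%N.
Proof.
move=> reg exy; rewrite -(reg x) card_gt0.
by apply/set0Pn; exists y; rewrite inE.
Qed.

Lemma adjmx_mul_const e k :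
  regular e k -> adjmx R e *m const_mx 1 = k%:R *: (const_mx 1 : 'M_#|V|).
Proof.
move=> reg; apply/matrixP => i j; rewrite !mxE mulr1 -(sum_adjmx_row i reg).
by apply: eq_bigr => m _; rewrite [const_mx _ _ _]mxE mulr1.
Qed.

(** The entries of the square count walks of length 2: [k] on the diagonal, the intersection number
    [a_1] on adjacent pairs, [c_2] at distance 2, and 0 elsewhere. Positivity of [c_2] is what makes
    [P_l2] a convex function of [P_l1]. *)
Lemma adjmx_sqr e k :
  simple_graph e -> distance_regular e -> regular e k ->
  (exists x y, at_distance e 2 x y) ->
  exists2 ac : R * R, 0 < ac.2 &
    adjmx R e *m adjmx R e =
      k%:R%:M + ac.1 *: adjmx R e + ac.2 *: adjmx R (at_distance e 2).
Proof.
move=> [e_sym e_irr] [_ [b [c bc]]] reg [x0 [y0 d2]].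
(* The first component is [a_1 = k - 1 - b_1]. *)
exists (k%:R - 1 - (b 1)%:R, (c 2)%:R) => /=.
  rewrite ltr0n -(proj2 (bc 1 x0 y0) d2) card_gt0; apply/set0Pn.
  move: d2; rewrite at_distance2 => /and3P[_ _ /existsP[z /andP[xz zy]]].
  by exists z; rewrite inE at_distance1 // xz e_sym zy.
apply/matrixP => i j; rewrite !mxE.
under eq_bigr do rewrite !mxE.
set x := enum_val i; set y := enum_val j.
rewrite (sum_enum_val (fun z => (e x z)%:R * (e z y)%:R)).
have -> : (i == j) = (x == y) by rewrite (inj_eq enum_val_inj).
have [<-|nxy] := eqVneq x y.
  rewrite e_irr at_distance2 eqxx /= !mulr0 !addr0 mulr1n.
  rewrite -(reg x) -sum_indicator.
  by apply: eq_bigr => z _; rewrite [e z x]e_sym -natrM mulnb andbb.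
rewrite mulr0n add0r.
have [exy|nexy] := boolP (e x y).
  rewrite at_distance2 exy andbF mulr0 addr0 mulr1.
  have d1 : at_distance e 1 x y by rewrite at_distance1.
  (* The [k] neighbours of [y] are [x], the [b 1] vertices at distance 2 from [x], and the common
     neighbours of [x] and [y]. Writing 1 as the indicator sum of [x] allows a comparison vertex by
     vertex. *)
  rewrite -(proj1 (bc 1 x y) d1) -(reg y) -!sum_indicator.
  have one_eq : 1 = \sum_z (z == x)%:R :> R.
    rewrite sum_indicator (_ : [set z | z == x] = [set x]) ?cards1 //.
    by apply/setP => z; rewrite !inE.
  rewrite [X in _ - X - _]one_eq -!sumrB; apply: eq_bigr => z _.
  rewrite -natrM mulnb at_distance2
     [e z y]e_sym [x == z]eq_sym.
  have [->|nzx] := eqVneq z x; first by rewrite e_irr e_sym exy /= subrr subr0.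
  case ezy: (e y z); rewrite /= ?andbF ?subr0 //.
  have -> : [exists t, e x t && e t z] by apply/existsP; exists y; rewrite exy.
  by case: (e x z); rewrite /= ?subr0 ?subrr.
rewrite mulr0 add0r.
have [d2xy|] := boolP (at_distance e 2 x y).
  rewrite mulr1 -(proj2 (bc 1 x y) d2xy) -sum_indicator.
  apply: eq_bigr => z _; rewrite -natrM mulnb at_distance1 // andbC.
  by rewrite [e z y]e_sym.
rewrite at_distance2 nxy nexy /= mulr0 => /existsPn nz.
by apply: big1 => z _; rewrite -natrM mulnb (negbTE (nz z)).
Qed.

Lemma scheme_spanP e d (M : 'M[R]_#|V|) :
  M \in scheme_span R e d ->
  exists q : 'I_d.+1 -> R, M = \sum_i q i *: adjmx R (at_distance e i).
Proof.
move=> /coord_span eqM.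
exists (fun i => coord [tuple adjmx R (at_distance e i) | i < d.+1] i M).
by rewrite {1}eqM; apply: eq_bigr => i _; rewrite -tnth_nth tnth_mktuple.
Qed.

Lemma tr_scheme_span e d (M : 'M[R]_#|V|) :
  symmetric e -> M \in scheme_span R e d -> M^T = M.
Proof.
move=> e_sym /scheme_spanP[q ->]; rewrite linear_sum; apply: eq_bigr => i _.
by rewrite linearZ /= tr_adjmx //; apply: at_distance_sym.
Qed.

(** The distance relations are pairwise disjoint, so a single term of the combination contributes to
    each entry. *)
Lemma scheme_span_entry e d (M : 'M[R]_#|V|) :
  M \in scheme_span R e d ->
  exists q : nat -> R, forall m i j, (m <= d)%N ->
    at_distance e m (enum_val i) (enum_val j) -> M i j = q m.
Proof.
move=> /scheme_spanP[q ->]; exists (fun m => q (inord m)) => m i j md dm.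
rewrite summxE (bigD1 (inord m)) //= big1 ?addr0 => [|l nl].
  by rewrite !mxE inordK // dm mulr1.
rewrite !mxE; case dl: (at_distance e l _ _); rewrite ?mulr0 //.
by case/eqP: nl; apply/val_inj; rewrite /= inordK // (at_distance_inj dl dm).
Qed.

End AdjacencyMatrix.

(** * Positive semidefinite matrices *)

Section Psd.
Variables (R : realType) (n : nat).
Implicit Types M N F : 'M[R]_n.

Lemma trmx_mul_self_ge0 m p (X : 'M[R]_(m, p)) (i : 'I_p) : 0 <= (X^T *m X) i i.
Proof.
by rewrite mxE; apply: sumr_ge0 => j _; rewrite mxE -expr2 sqr_ge0.
Qed.

Lemma psd_idem F : F^T = F -> F *m F = F -> psd F.
Proof.
move=> Ft FF; split=> // x.
have -> : x^T *m F *m x = (F *m x)^T *m (F *m x).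
  by rewrite trmx_mul Ft mulmxA -(mulmxA _ F F) FF.
exact: trmx_mul_self_ge0.
Qed.

Lemma psdD M N : psd M -> psd N -> psd (M + N).
Proof.
move=> [Mt M0] [Nt N0]; split=> [|x]; first by rewrite linearD /= Mt Nt.
by rewrite mulmxDr mulmxDl mxE addr_ge0.
Qed.

Lemma psdZ (a : R) M : 0 <= a -> psd M -> psd (a *: M).
Proof.
move=> a0 [Mt M0]; split=> [|x]; first by rewrite linearZ /= Mt.
by rewrite -scalemxAr -scalemxAl mxE mulr_ge0.
Qed.

(** The trace equals that of [F^T *m N *m F], whose diagonal entries are values of the quadratic
    form of [N] at the columns of [F]. *)
Lemma psd_mxtrace_idem N F :
  psd N -> F^T = F -> F *m F = F -> 0 <= \tr (N *m F).
Proof.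
move=> [_ N0] Ft FF.
have -> : \tr (N *m F) = \tr (F^T *m N *m F).
  by rewrite Ft -mulmxA (mxtrace_mulC F) -mulmxA FF.
apply: sumr_ge0 => i _; have := N0 (col i F).
rewrite tr_col -row_mul !mxE; under eq_bigr do rewrite !mxE.
by under [X in _ -> _ <= X]eq_bigr do rewrite !mxE.
Qed.

(** The quadratic form of [N] at the difference of the unit vectors of [i] and [j] is
    [2 * (a - N i j)]. *)
Lemma psd_entry_le N (a : R) i j :
  psd N -> N i i = a -> N j j = a -> N i j <= a.
Proof.
move=> [Nt N0] Ni Nj; have := N0 (delta_mx i 0 - delta_mx j 0).
rewrite [(_ - _)^T]linearB /= !trmx_delta mulmxBl !mulmxBr !mulmxBl.
rewrite -!rowE -!colE !mxE.
have -> : N j i = N i j by rewrite -{1}Nt mxE.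
by rewrite Ni Nj => h; lra.
Qed.

End Psd.

(** * Weak duality *)

Section LowerBound.
Variables (R : realType) (V : finType) (e1 e2 : rel V) (k1 k2 : nat).
Hypotheses (reg1 : regular e1 k1) (reg2 : regular e2 k2).

Lemma mxtrace_mul_adjmx_le (e : rel V) k (N : 'M[R]_#|V|) (a : R) :
  regular e k -> (forall i j, e (enum_val i) (enum_val j) -> N j i <= a) ->
  \tr (N *m adjmx R e) <= #|V|%:R * (k%:R * a).
Proof.
move=> reg Na; rewrite mxtrace_mulC.
have -> : #|V|%:R * (k%:R * a) = \sum_(i < #|V|) k%:R * a.
  by rewrite sumr_const card_ord mulr_natl.
apply: ler_sum => i _; rewrite mxE -(sum_adjmx_row R i reg) mulr_suml.
apply: ler_sum => j _; rewrite !mxE.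
by case eij: (e _ _); rewrite ?mul0r // !mul1r Na.
Qed.

Lemma gamma_feasible_lower_bound (z x y mu : R) (N : 'M[R]_#|V|) :
  (0 < #|V|)%N -> 0 <= x -> 0 <= y ->
  0 <= \tr (N *m (z%:M + x *: adjmx R e1 - y *: adjmx R e2)) ->
  gamma_feasible e1 e2 mu N ->
  x * k1%:R + y * k2%:R <= (z + x * k1%:R + y * k2%:R) * mu.
Proof.
move=> V0 x0 y0 trZ [mu0 [Nt _] Nd N1 N2].
have Nsym i j : N i j = N j i by rewrite -{1}Nt mxE.
(* On a constant diagonal [mu], the edge constraints become [N i j <= mu - 1] for [e1] and
   [- N i j <= mu - 1] for [e2]. *)
have le1 : \tr (N *m adjmx R e1) <= #|V|%:R * (k1%:R * (mu - 1)).
  apply: mxtrace_mul_adjmx_le reg1 _ => i j /N1.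
  by rewrite /Lstar !Nd [N i j]Nsym => h; lra.
have le2 : \tr (- N *m adjmx R e2) <= #|V|%:R * (k2%:R * (mu - 1)).
  apply: mxtrace_mul_adjmx_le reg2 _ => i j /N2.
  by rewrite /Kstar !Nd [N i j]Nsym mxE => h; lra.
rewrite mulNmx raddfN /= in le2.
have trN : \tr N = #|V|%:R * mu.
  rewrite /mxtrace (eq_bigr (fun=> mu)) // sumr_const card_ord.
  by rewrite mulr_natl.
move: trZ; rewrite mulmxBr mulmxDr raddfB raddfD /= -!scalemxAr !mxtraceZ.
rewrite mul_mx_scalar mxtraceZ trN => trZ.
have V0' : 0 < #|V|%:R :> R by rewrite ltr0n.
rewrite -(ler_pM2l V0').
have := ler_wpM2l x0 le1; have := ler_wpM2l y0 le2; lra.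
Qed.

End LowerBound.

(** * Primitive idempotents and eigenvalues of the scheme *)

Section Eigenmatrix.
Variables (R : realType) (V : finType) (e : rel V) (d : nat) (P : 'M[R]_d.+1).
Variable E : 'I_d.+1 -> 'M[R]_#|V|.
Hypotheses (e_simple : simple_graph e) (basisE : idempotent_basis e E).
Hypothesis eigenP : forall i : 'I_d.+1,
  adjmx R (at_distance e i) = \sum_(l < d.+1) P l i *: E l.

Lemma idempotent_basis_idem l : E l *m E l = E l.
Proof. by case: basisE => _ /(_ l)[]. Qed.

Lemma idempotent_basis_neq0 l : E l != 0.
Proof. by case: basisE => _ /(_ l)[]. Qed.

Lemma idempotent_basis_span l : E l \in scheme_span R e d.
Proof. by case: basisE => _ /(_ l)[]. Qed.

Lemma idempotent_basis_tr l : (E l)^T = E l.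
Proof.
by apply: tr_scheme_span (idempotent_basis_span l); case: e_simple.
Qed.

Lemma adjmx_mul_idem (i l : 'I_d.+1) :
  adjmx R (at_distance e i) *m E l = P l i *: E l.
Proof.
case: basisE => _ _ orthE _.
rewrite eigenP mulmx_suml (bigD1 l) //= big1 => [|m nml].
  by rewrite addr0 -scalemxAl idempotent_basis_idem.
by rewrite -scalemxAl orthE // scaler0.
Qed.

Lemma eigen_unique l (a b : R) : a *: E l = b *: E l -> a = b.
Proof.
move/eqP; rewrite -subr_eq0 -scalerBl scaler_eq0.
by rewrite (negPf (idempotent_basis_neq0 l)) orbF subr_eq0 => /eqP.
Qed.

(** Since [A_0] is the identity, multiplying it by [E l] shows [P l 0 *: E l = E l], and the
    expansion of [A_0] is the claim. *)
Lemma sum_idempotent_basis : \sum_l E l = 1%:M.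
Proof.
rewrite -(adjmx_at_distance0 R e) (eigenP ord0); apply: eq_bigr => l _.
by have := adjmx_mul_idem ord0 l; rewrite adjmx_at_distance0 mul1mx.
Qed.

(** [E ord0] is a multiple of the all-ones matrix, whose columns are eigenvectors of a regular graph
    for its degree. *)
Lemma first_row_eigenmatrix (i : 'I_d.+1) k :
  regular (at_distance e i) k -> P ord0 i = k%:R.
Proof.
move=> reg; apply: (@eigen_unique ord0); rewrite -adjmx_mul_idem.
case: basisE => _ _ _ ->.
by rewrite -scalemxAr (adjmx_mul_const _ reg) scalerA mulrC -scalerA.
Qed.

Lemma idem_comb_mxtrace_ge0 (w : 'I_d.+1 -> R) N :
  psd N -> (forall l, 0 <= w l) -> 0 <= \tr (N *m \sum_l w l *: E l).
Proof.
move=> psdN w0; rewrite mulmx_sumr raddf_sum; apply: sumr_ge0 => l _ /=.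
rewrite -scalemxAr mxtraceZ mulr_ge0 //.
by rewrite psd_mxtrace_idem ?idempotent_basis_tr ?idempotent_basis_idem.
Qed.

(* The relation between [q m] and [q 0] comes from the diagonals of
   [A_m E_l = P l m *: E_l]. *)
Lemma idem_entries l : exists2 q : nat -> R, 0 < q 0%N &
  (forall m i j, (m <= d)%N ->
     at_distance e m (enum_val i) (enum_val j) -> E l i j = q m) /\
  (forall (m : 'I_d.+1) k, regular (at_distance e m) k ->
     k%:R * q m = P l m * q 0%N).
Proof.
have [q Eq] := scheme_span_entry (idempotent_basis_span l).
(* As [E l] is a symmetric idempotent, its diagonal entries are the squared norms of its columns;
   they cannot all vanish. *)
have [i0 nz] : exists i, E l i i != 0.
  have [/forallP E0|] := boolP [forall i, E l i i == 0]; last first.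
    by rewrite negb_forall => /existsP.
  case/eqP: (idempotent_basis_neq0 l); apply/matrixP => j i; rewrite [RHS]mxE.
  have := eqP (E0 i).
  rewrite -{1}idempotent_basis_idem -{1}idempotent_basis_tr mxE.
  under eq_bigr do rewrite mxE -expr2.
  move=> /psumr_eq0P sq0; apply/eqP; rewrite -sqrf_eq0 sq0 // => m _.
  exact: sqr_ge0.
have Eii i : E l i i = q 0%N by apply: Eq => //; rewrite at_distance0.
exists q.
  rewrite lt_neqAle eq_sym -(Eii i0) nz /=.
  by rewrite -idempotent_basis_idem -{1}idempotent_basis_tr trmx_mul_self_ge0.
split=> // m k reg.
have := congr1 (fun M : 'M__ => M i0 i0) (adjmx_mul_idem m l).
rewrite !mxE Eii => <-; rewrite -(sum_adjmx_row R i0 reg) mulr_suml.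
apply: eq_bigr => j _; rewrite mxE.
case dm: (at_distance _ _ _ _); rewrite ?mul0r // (Eq m) //.
  by rewrite -ltnS.
by rewrite at_distance_sym //; case: e_simple.
Qed.

End Eigenmatrix.

(** The three equations place [(k, k2)], [(th, pd)] and [(t, p)] on one convex parabola, and between
    [th] and [k] the parabola lies below its chord. Multiplied by [c], the gap factors as
    [(k - th) * ((k - t) * (t - th))]. *)
Lemma eigenvalue_chord_ge0 (R : realFieldType) (a c k k2 th pd t p : R) :
  0 < c -> th <= t -> t <= k ->
  k ^+ 2 = k + a * k + c * k2 -> th ^+ 2 = k + a * th + c * pd ->
  t ^+ 2 = k + a * t + c * p ->
  0 <= (k - th) * k2 - (k2 - pd) * k + (k2 - pd) * t - (k - th) * p.
Proof.
move=> c0 tht tk ek eth et; rewrite -(pmulr_rge0 _ c0).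
have -> : c * ((k - th) * k2 - (k2 - pd) * k + (k2 - pd) * t - (k - th) * p) =
    (k - th) * ((k - t) * (t - th)).
  have -> : k2 = (k ^+ 2 - k - a * k) / c by rewrite ek; field; lra.
  have -> : pd = (th ^+ 2 - k - a * th) / c by rewrite eth; field; lra.
  have -> : p = (t ^+ 2 - k - a * t) / c by rewrite et; field; lra.
  by field; lra.
by rewrite !mulr_ge0 ?subr_ge0 // (le_trans tht).
Qed.

Theorem theorem9 (R : realType) (V : finType) (e1 e2 : rel V) (d k1 k2 : nat)
    (P : 'M[R]_d.+1)
    (he1 : simple_graph e1) (hdr : distance_regular e1)
    (hd : has_diameter e1 d) (hd2 : (2 <= d)%N)
    (he2 : e2 =2 at_distance e1 2)
    (hk1 : regular e1 k1) (hk2 : regular e2 k2)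
    (hP : first_eigenmatrix e1 P)
    (hord : forall l m : 'I_d.+1, (l < m)%N -> P m (inord 1) < P l (inord 1)) :
  let Pd1 := P ord_max (inord 1) in
  let Pd2 := P ord_max (inord 2) in
  is_gamma_circ e1 e2
    (if 0 < k2%:R * Pd1 + k1%:R * Pd2
     then k1%:R / (k1%:R - Pd1)
     else k1%:R / (k1%:R - Pd1)
          - (k2%:R * Pd1 + k1%:R * Pd2) / (2 * k2%:R * (k1%:R - Pd1))).
Proof.
rewrite /=; set th : R := P ord_max (inord 1).
set pd : R := P ord_max (inord 2).
have [[x0 [yd distd]] _] := hd.
have [z1 dist1] := at_distance_take (ltnW hd2) distd.
have [y0 dist2] := at_distance_take hd2 distd.
have V0 : (0 < #|V|)%N by apply/card_gt0P; exists x0.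
have lt1d : (1 < d.+1)%N by apply: ltnW.
have val1 : (inord 1 : 'I_d.+1) = 1%N :> nat by rewrite inordK.
have val2 : (inord 2 : 'I_d.+1) = 2%N :> nat by rewrite inordK.
have e1_dist1 : e1 =2 at_distance e1 1.
  by move=> x y; rewrite at_distance1 //; case: he1.
have reg1 : regular (at_distance e1 (inord 1 : 'I_d.+1)) k1.
  move=> x; rewrite val1 -(hk1 x).
  by apply: eq_card => y; rewrite !inE e1_dist1.
have reg2 : regular (at_distance e1 (inord 2 : 'I_d.+1)) k2.
  by move=> x; rewrite val2 -(hk2 x); apply: eq_card => y; rewrite !inE he2.
have k1_gt0 : 0 < k1%:R :> R.
  by rewrite ltr0n (@regular_gt0 _ _ _ x0 z1 reg1) // val1.
have k2_gt0 : 0 < k2%:R :> R.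
  by rewrite ltr0n (@regular_gt0 _ _ _ x0 y0 reg2) // val2.
have [E basisE eigenP] := hP.
have P01 := first_row_eigenmatrix basisE eigenP reg1.
have P02 := first_row_eigenmatrix basisE eigenP reg2.
have th_lt : th < k1%:R by rewrite -P01; apply: hord; apply: ltnW.
have den_gt0 : 0 < k1%:R - th by rewrite subr_gt0.
have A1E : adjmx R e1 = adjmx R (at_distance e1 (inord 1 : 'I_d.+1)).
  by rewrite val1; apply: eq_adjmx.
have A2E : adjmx R e2 = adjmx R (at_distance e1 (inord 2 : 'I_d.+1)).
  by rewrite val2; apply: eq_adjmx.
have [[a c] /= c_gt0 sqrA1] :=
  adjmx_sqr R he1 hdr hk1 (ex_intro _ x0 (ex_intro _ y0 dist2)).
(* Multiplying the identity for the square of [A_1] by [E l] turns it into one between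
   eigenvalues. *)
have quad l : P l (inord 1) ^+ 2 =
    k1%:R + a * P l (inord 1) + c * P l (inord 2).
  apply: (eigen_unique basisE (l := l)).
  have A1l : adjmx R e1 *m E l = P l (inord 1) *: E l.
    by rewrite A1E (adjmx_mul_idem basisE eigenP).
  have A2l : adjmx R (at_distance e1 2) *m E l = P l (inord 2) *: E l.
    by rewrite -(adjmx_mul_idem basisE eigenP) val2.
  have := congr1 (mulmx^~ (E l)) sqrA1.
  rewrite -mulmxA A1l -scalemxAr A1l scalerA -expr2 => ->.
  by rewrite !mulmxDl mul_scalar_mx -!scalemxAl A1l A2l !scalerA -!scalerDl.
have P_le l : P l (inord 1) <= k1%:R.
  rewrite -P01; have [->//|] := eqVneq l ord0.
  by move=> nl; apply/ltW/hord; rewrite lt0n.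
have P_ge l : th <= P l (inord 1).
  have [->//|nl] := eqVneq l ord_max; apply/ltW/hord.
  by rewrite ltn_neqAle leq_ord andbT.
have [q q0_gt0 [Eq kq]] := idem_entries he1 basisE eigenP ord_max.
have q1E : k1%:R * q 1%N = th * q 0%N by rewrite -(kq _ _ reg1) val1.
have q2E : k2%:R * q 2%N = pd * q 0%N by rewrite -(kq _ _ reg2) val2.
have psdE l : psd (E l).
  apply: psd_idem; first exact: (idempotent_basis_tr he1 basisE).
  exact: (idempotent_basis_idem basisE).
have diagE i : E ord_max i i = q 0%N by apply: Eq => //; rewrite at_distance0.
(* This gives [pd <= k2], which makes the weight [k2 - pd] of [A_1] in the second dual matrix
   nonnegative. *)
have q2_le : q 2%N <= q 0%N.
  rewrite -(Eq 2%N (enum_rank x0) (enum_rank y0)) ?enum_rankK //.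
  exact: psd_entry_le.
have pd_le : pd <= k2%:R.
  by rewrite -(ler_pM2r q0_gt0) -q2E ler_pM2l.
(* In the basis [E], the matrix [z I + x A_1 - y A_2] has the displayed numbers as coefficients, so
   their nonnegativity suffices for the trace condition. *)
have bound (z x y mu : R) N : 0 <= x -> 0 <= y ->
    (forall l, 0 <= z + x * P l (inord 1) - y * P l (inord 2)) ->
    gamma_feasible e1 e2 mu N ->
    x * k1%:R + y * k2%:R <= (z + x * k1%:R + y * k2%:R) * mu.
  move=> x_ge0 y_ge0 w_ge0 feas.
  apply: (gamma_feasible_lower_bound hk1 hk2 V0 x_ge0 y_ge0 _ feas).
  rewrite A1E A2E !eigenP -scalemx1 -(sum_idempotent_basis basisE eigenP).
  rewrite !scaler_sumr -big_split -sumrB /=.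
  under eq_bigr do rewrite !scalerA -scalerDl -scalerBl.
  by apply: (idem_comb_mxtrace_ge0 he1 basisE) => //; case: feas.
(* The scaling of [E ord_max] to diagonal [t] makes every [e1] constraint tight:
   [t * (1 - th / k1) = 1]. Adding [s J] leaves these constraints unchanged, while each [e2]
   constraint becomes [1 <= 2 * s + t * (1 + pd / k2)]. *)
pose t := k1%:R / (k1%:R - th).
have t_ge0 : 0 <= t by rewrite divr_ge0 // ltW.
have attained (s : R) : 0 <= s -> 1 - t * (1 + pd / k2%:R) <= 2 * s ->
    gamma_feasible e1 e2 (s + t)
      (s *: const_mx 1 + (t / q 0%N) *: E ord_max).
  move=> s_ge0 s_le; split.
  - by rewrite addr_ge0.
  - apply: psdD; last by apply: psdZ => //; rewrite divr_ge0 // ltW.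
    apply: psdZ => //.
    have -> : const_mx 1 = #|V|%:R *: E ord0.
      case: basisE => _ _ _ ->.
      by rewrite scalerA divff ?scale1r // pnatr_eq0 -lt0n.
    by apply: psdZ => //; rewrite ler0n.
  - by move=> i; rewrite !mxE diagE mulr1 divfK // gt_eqF.
  - move=> i j; rewrite e1_dist1 => dij; rewrite /Lstar !mxE !diagE.
    rewrite (Eq 1%N) // 1?ltnW //.
    have -> : q 1%N = th * q 0%N / k1%:R.
      by rewrite -q1E [RHS]mulrC mulKf ?gt_eqF.
    rewrite /t le_eqVlt; apply/orP; left; apply/eqP; field.
    by rewrite !gt_eqF.
  - move=> i j; rewrite he2 => dij; rewrite /Kstar !mxE !diagE (Eq 2%N) //.
    have -> : q 2%N = pd * q 0%N / k2%:R.
      by rewrite -q2E [RHS]mulrC mulKf ?gt_eqF.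
    move: s_le; rewrite !mulr1 !divfK ?gt_eqF //.
    have -> : t / q 0%N * (pd * q 0%N / k2%:R) = t * (pd / k2%:R).
      by field; rewrite !gt_eqF.
    lra.
have lb1 mu N : gamma_feasible e1 e2 mu N -> t <= mu.
  move=> feas.
  have w_ge0 l : 0 <= - th + 1 * P l (inord 1) - 0 * P l (inord 2).
    by have := P_ge l; lra.
  have := bound _ _ _ _ _ ler01 (lexx 0) w_ge0 feas.
  by rewrite ler_pdivrMr //; lra.
have lb2 mu N : gamma_feasible e1 e2 mu N ->
    t - (k2%:R * th + k1%:R * pd) / (2 * k2%:R * (k1%:R - th)) <= mu.
  move=> feas.
  have pd_le' : 0 <= k2%:R - pd by rewrite subr_ge0.
  (* The weights [x = k2 - pd] and [y = k1 - th] give equal values of [x P_l1 - y P_l2] at [l = 0]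
     and [l = d]; [z] is then chosen to cancel that value. The resulting factor [z + x k1 + y k2] of
     [mu] is [2 * k2 * (k1 - th)]. *)
  have w_ge0 l : 0 <= (k1%:R - th) * k2%:R - (k2%:R - pd) * k1%:R
      + (k2%:R - pd) * P l (inord 1) - (k1%:R - th) * P l (inord 2).
    apply: (eigenvalue_chord_ge0 c_gt0 (P_ge l) (P_le l) _ (quad _) (quad l)).
    by have := quad ord0; rewrite P01 P02.
  have := bound ((k1%:R - th) * k2%:R - (k2%:R - pd) * k1%:R) (k2%:R - pd)
    (k1%:R - th) mu N pd_le' (ltW den_gt0) w_ge0 feas => h.
  have -> : t - (k2%:R * th + k1%:R * pd) / (2 * k2%:R * (k1%:R - th)) =
      ((k2%:R - pd) * k1%:R + (k1%:R - th) * k2%:R)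
        / (2 * k2%:R * (k1%:R - th)).
    by rewrite /t; field; rewrite !gt_eqF.
  by rewrite ler_pdivrMr ?mulr_gt0 //; lra.
(* The sign in the case distinction decides whether the [e2] constraints already hold at [s = 0]. If
   not strictly, [s] is taken as half of this shortfall, which makes them tight. *)
have slackE : 1 - t * (1 + pd / k2%:R) =
    - (2 * ((k2%:R * th + k1%:R * pd) / (2 * k2%:R * (k1%:R - th)))).
  by rewrite /t; field; rewrite !gt_eqF.
have den2_gt0 : 0 < 2 * k2%:R * (k1%:R - th) by rewrite !mulr_gt0.
case: ltP => sgn; split=> //.
- exists (0 *: const_mx 1 + (t / q 0%N) *: E ord_max).
  have := @attained 0 (lexx 0); rewrite add0r slackE; apply.
  by rewrite mulr0 oppr_le0 mulr_ge0 // divr_ge0 // ltW.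
- rewrite addrC; eexists; apply: attained; last by rewrite slackE mulrN.
  by rewrite oppr_ge0 mulr_le0_ge0 // invr_ge0 ltW.
Qed.
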